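(* Let $r\in(0,1]$ be such that $\lambda(0)<1$, so that $\rho^*\in(0,1/2)$. Let $\rho_0:\mathbb R\to[0,1]$ be a macroscopic profile that is piecewise continuous in each bounded interval and satisfies $\rho^*\le\rho_0(x)\le1-\rho^*$ for all $x$. Suppose $\rho_0$ is invariant under the macroscopic dynamics, that is, for all times $t$, $\rho(x,t)=\rho_0(x)$ for a.e. $x$, where $\rho(x,t)$ is the profile evolved from $\rho_0$ by the variational formula in the context. Then Lebesgue-almost everywhere $\rho_0(x)\in\{\rho^*,1-\rho^*\}$, and (up to Lebesgue null sets) $\rho_0$ takes $0$ to $3$ jumps (i.e. it is piecewise constant with at most three jumps) according to these restrictions: a jump from $1-\rho^*$ to $\rho^*$ (as $x$ increases) can occur only at the origin, while jumps from $\rho^*$ to $1-\rho^*$ can occur at any $x\in\mathbb R$.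
   Context: Definition of $\kappa(r)$ for $r\in(0,1]$: let $Y_{i,j}$, $(i,j)\in\mathbb N^2$ ($\mathbb N=\{1,2,\dots\}$), be i.i.d. exponential random variables with mean $1$, and let $w_{i,j}=1$ if $i\neq j$, $w_{i,i}=1/r$. Let $T_{n,n}=\max_\pi\sum_{k=1}^{2n-1}w_{i_k,j_k}Y_{i_k,j_k}$, the maximum over paths $\pi=\{(1,1)=(i_1,j_1),\dots,(i_{2n-1},j_{2n-1})=(n,n)\}$ with $(i_k,j_k)-(i_{k-1},j_{k-1})\in\{(1,0),(0,1)\}$. The a.s. limit $\kappa(r)=\lim_{n\to\infty}n^{-1}T_{n,n}$ exists and is a constant, and $\kappa(r)\ge4$. Macroscopic rate profile: $\lambda(x)=1$ for $x\ne0$ and $\lambda(0)=4/\kappa(r)\in(0,1]$. Critical density: $\rho^*=\frac12-\frac12\sqrt{1-\lambda(0)}$. $g_0(x)=\sup_{0\le\rho\le1}\{\rho(1-\rho)-x\rho\}$, i.e. $g_0(x)=-x$ for $x\le-1$, $g_0(x)=\frac14(1-x)^2$ for $-1\le x\le1$, $g_0(x)=0$ for $x\ge1$. Macroscopic dynamics: given a measurable $\rho_0:\mathbb R\to[0,1]$, let $v_0(0)=0$, $v_0(b)-v_0(a)=\int_a^b\rho_0(x)\,dx$. Set $v(x,0)=v_0(x)$ and, for $t>0$, $$v(x,t)=\sup_{w(\cdot)}\Big\{v_0(w(0))-\int_0^t\lambda(w(s))\,g_0\Big(\frac{w'(s)}{\lambda(w(s))}\Big)ds\Big\},$$ the supremum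 over (continuous) piecewise $C^1$ paths $w:[0,t]\to\mathbb R$ with $w(t)=x$. For fixed $t$, $v(\cdot,t)$ is Lipschitz and $\rho(x,t)=\frac{\partial}{\partial x}v(x,t)$ (defined for a.e. $x$). *)

(* Defs.v *)
From HB Require Import structures.
From mathcomp Require Import all_boot all_order all_algebra.
From mathcomp Require Import all_classical all_reals all_analysis.

Set Implicit Arguments.
Unset Strict Implicit.
Unset Printing Implicit Defensive.

Import Order.TTheory GRing.Theory Num.Theory.
Import numFieldTopology.Exports numFieldNormedType.Exports.

Local Open Scope classical_set_scope.
Local Open Scope ring_scope.

(* Sites are shifted to start at 0: (i, j) stands for the site (i+1, j+1). *)
Definition site := (nat * nat)%type.

Definition up_right (z z' : site) : bool :=
  (z' == (z.1.+1, z.2)) || (z' == (z.1, z.2.+1)).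

Section LastPassage.
Context {R : realType}.

Definition diag_weight (r : R) (z : site) : R :=
  if z.1 == z.2 then r^-1 else 1.

(* With the shift, this is T_{n+1,n+1}.  The set of paths is finite and
   nonempty, so the supremum is a maximum. *)
Definition last_passage (r : R) (y : site -> R) (n : nat) : R :=
  sup [set (\sum_(z <- (0, 0)%N :: p) diag_weight r z * y z) |
       p in [set p : seq site | path up_right (0, 0)%N p &&
                                (last (0, 0)%N p == (n, n))]].

Definition mutually_independent d (T : measurableType d) (P : probability T R)
    (I : eqType) (X : I -> {RV P >-> R}) : Prop :=
  forall (J : seq I) (B : I -> set R), uniq J -> (forall i, measurable (B i)) ->
    P (\bigcap_(i in [set` J]) (X i @^-1` B i)) =
    (\prod_(i <- J) P (X i @^-1` B i))%E.

Definition iid_exponential d (T : measurableType d) (P : probability T R)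
    (Y : site -> {RV P >-> R}) : Prop :=
  mutually_independent Y /\
  forall z (B : set R), measurable B ->
    distribution P (Y z) B = exponential_prob (1 : R) B.

(* The limit depends only on the joint law of the variables, hence not on the
   probability space. *)
Definition is_kappa (r kappa : R) : Prop :=
  exists (d : measure_display) (T : measurableType d) (P : probability T R)
         (Y : site -> {RV P >-> R}),
    iid_exponential Y /\
    {ae P, forall w,
      last_passage r (fun z => Y z w) n / n.+1%:R @[n --> \oo] --> kappa}.

End LastPassage.

Section Dynamics.
Context {R : realType}.
Local Notation mu := (@lebesgue_measure R).

Definition rate (kappa x : R) : R := if x == 0 then 4 / kappa else 1.

Definition rho_star (kappa : R) : R :=
  2^-1 - 2^-1 * Num.sqrt (1 - rate kappa 0).

Definition g0 (x : R) : R :=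
  sup [set rho * (1 - rho) - x * rho | rho in `[0, 1]%classic].

Definition initial_height (rho0 : R -> R) (x : R) : R :=
  if 0 <= x then \int[mu]_(y in `[0, x]) rho0 y
  else - \int[mu]_(y in `[x, 0]) rho0 y.

(* C^1 on a closed piece means: restriction of a C^1 function on the line, so
   that one-sided derivatives exist at the breakpoints. *)
Definition piecewise_C1 (t : R) (w : R -> R) : Prop :=
  {within `[0, t], continuous w} /\
  exists s : seq R, itv_partition 0 t s /\
    forall i, (i < size s)%N -> exists h : R -> R,
      [/\ forall x, derivable h x 1, continuous (h^`())%classic &
          {in `[nth 0 (0 :: s) i, nth 0 s i], w =1 h}].

(* The suprema are over nonempty sets, bounded above when rho0 takes values in
   [0, 1]; the derivative of w is only used off the finitely many breakpoints. *)
Definition height (kappa : R) (rho0 : R -> R) (x t : R) : R :=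
  if t == 0 then initial_height rho0 x else
  sup [set initial_height rho0 (w 0) -
           \int[mu]_(s in `[0, t])
             (rate kappa (w s) * g0 ((w^`())%classic s / rate kappa (w s))) |
       w in [set w : R -> R | piecewise_C1 t w /\ w t = x]].

(* Finitely many pieces, with finite one-sided limits at their endpoints. *)
Definition piecewise_continuous (a b : R) (f : R -> R) : Prop :=
  exists s : seq R, itv_partition a b s /\
    forall i, (i < size s)%N -> exists h : R -> R,
      continuous h /\ {in `]nth 0 (a :: s) i, nth 0 s i[, f =1 h}.

Definition invariant_profile (kappa : R) (rho0 : R -> R) : Prop :=
  forall t : R, 0 <= t ->
    {ae mu, forall x : R, is_derive x (1 : R) (height kappa rho0 ^~ t) (rho0 x)}.

(* s lists the jump locations in increasing order and c i is the constant value
   between the i-th and the (i+1)-st of them, so that the profile jumps from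
   c i to c i.+1 at s`_i. *)
Definition jumps_at (s : seq R) (c : nat -> R) (f : R -> R) : Prop :=
  [/\ sorted <%R s,
      forall i, (i < size s)%N -> c i != c i.+1 &
      {ae mu, forall x, f x = c (count (fun a => a < x) s)}].

End Dynamics.

(* Main.v *)
Require Import Defs.
From HB Require Import structures.
From mathcomp Require Import all_boot all_order all_algebra.
From mathcomp Require Import all_classical all_reals all_analysis.
From mathcomp Require Import measurable_realfun ring lra.
Import Order.TTheory GRing.Theory Num.Theory.
Import numFieldTopology.Exports numFieldNormedType.Exports.
Local Open Scope classical_set_scope.
Local Open Scope ring_scope.

(** Write f(p) = p(1 - p), q = rho_star and lam = lambda(0), so that f(q) = lam/4.
    For the slopes p = q and p = 1 - q, Legendre duality gives, almost everywhere along any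
    path w, the bound  cost >= f(q) - p w': at the origin w' = 0 for almost every time spent
    there and the cost is lam/4, elsewhere it is the inequality g0(u) >= f(p) - p u.
    Away from the origin one also has  cost >= 1/4 - w'/2.

    Since v(.,t) is 1-Lipschitz and has derivative rho_0 almost everywhere, v(.,t) - v_0 is
    constant, and waiting at the origin shows that the constant is at least - t f(q).  Let
    x > 0 with v_0(x) > q x.  A path ending at x that visits the origin has value at most
    - t f(q) + q x < v_0(x) - t f(q), so near-optimal paths avoid the origin.  For t large
    they lose at rate 1/4 > f(q) unless they start arbitrarily far to the right of x, and
    then the bound with p = 1 - q forces v_0 to have slope 1 - q on [x, oo).  Hence on
    (0, oo) the profile is q up to some point and 1 - q after it; reflection settles
    (-oo, 0). *)

Set Implicit Arguments.
Unset Strict Implicit.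

(** * Legendre duality between [g0] and the flux p(1 - p) *)

Section LegendreTransform.
Context {R : realType}.
Implicit Types x y p u : R.

Lemma g0_has_sup x :
  has_sup [set rho * (1 - rho) - x * rho | rho in `[(0 : R), 1]%classic].
Proof.
split; first by exists (0 * (1 - 0) - x * 0), 0 => //=; rewrite in_itv /= lexx ler01.
exists (1 + `|x|) => _ [p /= + <-]; rewrite in_itv /= => /andP[p0 p1].
have : - (x * p) <= `|x|.
  by rewrite (le_trans (ler_norm _)) // normrN normrM (ger0_norm p0) ler_piMr.
nra.
Qed.

Lemma g0_ge x p : 0 <= p <= 1 -> p * (1 - p) - x * p <= g0 x.
Proof.
move=> p01; apply: sup_upper_bound; first exact: g0_has_sup.
by exists p => //=; rewrite in_itv.
Qed.

Lemma g0_le x u :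
  (forall p, 0 <= p <= 1 -> p * (1 - p) - x * p <= u) -> g0 x <= u.
Proof.
move=> H; apply: ge_sup; first by case: (g0_has_sup x).
by move=> _ [p /= + <-]; rewrite in_itv /=; exact: H.
Qed.

Lemma g0_ge0 x : 0 <= g0 x.
Proof. by have := @g0_ge x 0; rewrite lexx ler01 => /(_ isT); lra. Qed.

Lemma g0_le_norm x : g0 x <= 1 + `|x|.
Proof.
apply: g0_le => p /andP[p0 p1].
have : - (x * p) <= `|x|.
  by rewrite (le_trans (ler_norm _)) // normrN normrM (ger0_norm p0) ler_piMr.
nra.
Qed.

(** Each function in the supremum is nonincreasing in x, because p >= 0. This monotonicity is the
    source of measurability of the cost along a path. *)
Lemma g0_nonincreasing : {homo @g0 R : x y / x <= y >-> y <= x}.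
Proof.
move=> x y xy; apply: g0_le => p p01; apply: (le_trans _ (g0_ge x p01)).
by case/andP: p01 => p0 _; nra.
Qed.

Lemma g0_0 : @g0 R 0 = 4^-1.
Proof.
apply/eqP; rewrite eq_le; apply/andP; split.
  by apply: g0_le => p _; have := sqr_ge0 (p - 2^-1); rewrite expr2; lra.
have := @g0_ge 0 2^-1; have -> : (0 <= 2^-1 :> R) && (2^-1 <= 1 :> R) by lra.
by move=> /(_ isT); lra.
Qed.

Lemma g0_ge1 u : 1 <= u -> g0 u <= 0.
Proof. by move=> u1; apply: g0_le => p /andP[p0 p1]; nra. Qed.

Lemma g0_leN1 u : u <= -1 -> g0 u <= - u.
Proof. by move=> u1; apply: g0_le => p /andP[p0 p1]; nra. Qed.

End LegendreTransform.

(** * Lipschitz functions whose derivative vanishes almost everywhere *)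

Section LipschitzConstant.
Context {R : realType}.
Local Notation mu := (@lebesgue_measure R).

(** Let c be the supremum of the points of [a, b] that satisfy [P]. The closure hypothesis gives [P]
    at c from nearby points on its left, and the step hypothesis then rules out c < b. *)
Lemma real_induction (P : R -> Prop) (a b : R) : a <= b -> P a ->
  (forall c, a < c <= b ->
     (forall d, 0 < d -> exists2 s, P s & a <= s <= c /\ c - s < d) -> P c) ->
  (forall c, a <= c < b -> P c -> exists2 s, P s & c < s <= b) ->
  P b.
Proof.
move=> ab Pa Pcl Pstep.
pose S := [set s | a <= s <= b /\ P s].
have Sa : S a by split; rewrite // lexx.
have hS : has_sup S by split; [exists a|exists b => s [/andP[]]].
have ac : a <= sup S by apply: sup_upper_bound.
have cb : sup S <= b by apply: ge_sup; [exists a|move=> s [/andP[]]].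
have Pc : P (sup S).
  have [<- //|ac'] := eqVneq a (sup S).
  apply: Pcl; first by rewrite lt_def eq_sym ac' ac.
  move=> d d0; have [s [/andP[as_ sb] Ps] ds] := sup_adherent d0 hS.
  have sc : s <= sup S by apply: sup_upper_bound => //; split => //; apply/andP.
  by exists s => //; rewrite as_ sc; split => //; lra.
have [<- //|cb'] := eqVneq (sup S) b.
have [|s Ps /andP[cs sb]] := Pstep _ _ Pc; first by rewrite ac lt_def eq_sym cb' cb.
have : s <= sup S by apply: sup_upper_bound => //; split => //; rewrite sb andbT; lra.
lra.
Qed.

Lemma is_derive_near (f : R -> R) (x l e : R) : is_derive x (1 : R) f l -> 0 < e ->
  exists2 d, 0 < d & forall y, `|y - x| < d ->
    `|f y - f x - l * (y - x)| <= e * `|y - x|.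
Proof.
move=> [df fl] e0; move: df; rewrite /derivable => /cvg_ex[l' /= cl].
have ll' : l' = l by rewrite -fl /derive; apply/esym/cvg_lim.
move: cl; rewrite ll' => /cvgrPdist_le /(_ _ e0) /nbhs_ballP[d /= d0 Hd].
exists d => // y yd.
have [->|yx] := eqVneq y x; first by rewrite !subrr mulr0 normr0 subrr normr0 mulr0.
have yx0 : y - x != 0 by rewrite subr_eq0.
have := Hd (y - x); rewrite /ball /= sub0r normrN => /(_ yd yx0).
rewrite /GRing.scale /= mulr1 subrK => H.
have -> : f y - f x - l * (y - x) = - ((l - (y - x)^-1 * (f y - f x)) * (y - x)) by field.
by rewrite normrN normrM ler_wpM2r.
Qed.

(* The increments are charged to the derivative off an open set U of small measure
   containing the bad null set, and to the Lipschitz bound, hence to mu U, on U. *)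
Lemma lipschitz_derive0_constant (f : R -> R) (k : R) : 0 <= k ->
  (forall x y, x <= y -> `|f y - f x| <= k * (y - x)) ->
  {ae mu, forall x, is_derive x (1 : R) f (0 : R)} ->
  forall x y, f x = f y.
Proof.
move=> k0 lip [M [mM M0 NM]].
suff H x y : x <= y -> f y = f x.
  by move=> x y; have [/H|/ltW/H] := leP x y.
move=> xy.
(* The bound is linear in e, so any positive error is reached by rescaling e; the extra 1 in the
   divisor keeps it positive. *)
suff He e : 0 < e -> `|f y - f x| <= e * (y - x + k).
  apply/eqP; rewrite -subr_eq0 -normr_le0; apply/ler_addgt0Pr => e e0; rewrite add0r.
  have p0 : 0 < y - x + k + 1 by lra.
  apply: le_trans (He (e / (y - x + k + 1)) _) _; first exact: divr_gt0.
  rewrite mulrAC ler_pdivrMr //.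
  by rewrite ler_pM2l //; lra.
move=> e0.
have [|U [oU MU Ue]] := lebesgue_regularity_outer mM _ e0.
  by rewrite [X in (X < _)%E]M0 ltry.
have mU : measurable U by exact: open_measurable.
have {}Ue : (mu U < e%:E)%E.
  apply: le_lt_trans Ue.
  have mUM : measurable (U `\` M) by exact: measurableD.
  rewrite -[X in (mu X <= _)%E](setDUK MU).
  apply: le_trans (measureU2 _ _ _) _ => //.
  by rewrite [X in (X + _)%E]M0 add0e.
have le_mu (A B : set R) : measurable A -> measurable B -> A `<=` B -> (mu A <= mu B)%E.
  by move=> mA mB AB; apply: le_measure => //; apply/mem_set.
pose m s := fine (mu (U `&` `]x, s])).
have mE s : (mu (U `&` `]x, s]) = (m s)%:E)%E.
  rewrite /m fineK // ge0_fin_numE //; apply: le_lt_trans (lt_trans Ue (ltry _)).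
  by apply: le_mu => //; exact: measurableI.
have mU_itv s : measurable (U `&` `]x, s]) by apply: measurableI.
have m_ge0 s : 0 <= m s by rewrite -lee_fin -mE.
have m_homo s s' : s <= s' -> m s <= m s'.
  move=> ss'; rewrite -lee_fin -!mE; apply: le_mu => //.
  rewrite /=. move=> z [Uz /=]; rewrite !in_itv /= => /andP[-> zs].
  by split => //; exact: le_trans zs ss'.
have m_step s s' : x <= s <= s' -> `]s, s'] `<=` U -> s' - s <= m s' - m s.
  move=> /andP[xs ss'] sU; rewrite lerBrDr -lee_fin EFinD -!mE.
  have <- : mu `]s, s'] = (s' - s)%:E.
    rewrite lebesgue_measure_itv /= lte_fin; case: ltP => // s's.
    by have -> : s' = s by [lra]; rewrite subrr.
  rewrite -measureU //; last first.
    apply/seteqP; split => // z [/=]; rewrite !in_itv /= => /andP[sz _] [_ /andP[_ zs]].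
    by lra.
  - exact: mU_itv.
  apply: le_mu => //; first exact: measurableU.
  move=> z [zs|[Uz]] /=; first by split; [exact: sU|move: zs; rewrite /= !in_itv /=; lra].
  by rewrite !in_itv /= => zs; split => //; lra.
have m_lt s : m s <= e.
  rewrite -lee_fin -mE ltW //; apply: le_lt_trans Ue.
  exact: le_mu.
suff: `|f y - f x| <= e * (y - x) + k * m y.
  by move/le_trans; apply; have := ler_wpM2l k0 (m_lt y); lra.
apply: (@real_induction (fun s => `|f s - f x| <= e * (s - x) + k * m s) x y xy).
- by rewrite !subrr normr0 mulr0 add0r mulr_ge0.
- move=> c /andP[xc cy] near_c; apply/ler_addgt0Pr => d d0.
  have k1 : 0 < k + 1 by lra.
  have [|s Ps [/andP[xs sc] csd]] := near_c (d / (k + 1)); first exact: divr_gt0.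
  have -> : f c - f x = (f c - f s) + (f s - f x) by ring.
  apply: le_trans (ler_normD _ _) _.
  have h1 := lip _ _ sc; have h2 := ler_wpM2l k0 (m_homo _ _ sc).
  have h3 : k * (c - s) <= d.
    move: csd; rewrite ltr_pdivlMr // => csd.
    by apply: le_trans (ltW csd); nra.
  have h4 : e * (s - x) <= e * (c - x) by rewrite ler_pM2l //; lra.
  by lra.
move=> c /andP[xc cy] Pc.
(* There are two ways to advance from c. At a point of [M] an interval to the right lies in [U], so
   its length is paid by an increase of [m]; elsewhere the zero derivative limits the growth rate to
   e for a short while. *)
have [cM|cM] := pselect (M c).
  have /nbhs_ballP[d d0 dU] : nbhs c U by apply: open_nbhs_nbhs; split => //; exact: MU.
  have d0' : 0 < d := d0.
  pose s := Num.min (c + d / 2) y.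
  have cs : c < s by rewrite lt_min cy andbT; lra.
  have sd : s <= c + d / 2 by rewrite ge_min lexx.
  exists s; last by rewrite cs ge_min lexx orbT.
  have -> : f s - f x = (f s - f c) + (f c - f x) by ring.
  apply: le_trans (ler_normD _ _) _.
  have h1 := lip _ _ (ltW cs).
  have h2 : s - c <= m s - m c.
    apply: m_step; first by rewrite xc ltW.
    move=> z /=; rewrite in_itv /= => /andP[cz zs]; apply: dU.
    by rewrite /ball /= ltr0_norm; lra.
  have := ler_wpM2l k0 h2.
  have : e * (c - x) <= e * (s - x) by rewrite ler_pM2l //; lra.
  by lra.
have dc : is_derive c (1 : R) f (0 : R) by apply: contrapT => nd; apply: cM; apply: NM.
have [d d0 Hd] := is_derive_near dc e0.
pose s := Num.min (c + d / 2) y.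
have cs : c < s by rewrite lt_min cy andbT; lra.
have sd : s <= c + d / 2 by rewrite ge_min lexx.
exists s; last by rewrite cs ge_min lexx orbT.
have -> : f s - f x = (f s - f c) + (f c - f x) by ring.
apply: le_trans (ler_normD _ _) _.
have := Hd s; rewrite mul0r subr0 gtr0_norm ?subr_gt0 // => /(_ ltac:(lra)) h1.
have := ler_wpM2l k0 (m_homo _ _ (ltW cs)).
by lra.
Qed.

End LipschitzConstant.

(** * Integrals over intervals, and zeros of differentiable functions *)

Section IntegralLemmas.
Context {R : realType}.
Local Notation mu := (@lebesgue_measure R).

Lemma le_ae_Rintegral (D : set R) (f g : R -> R) : measurable D ->
  mu.-integrable D (EFin \o f) -> mu.-integrable D (EFin \o g) ->
  {ae mu, forall x, D x -> f x <= g x} ->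
  \int[mu]_(x in D) f x <= \int[mu]_(x in D) g x.
Proof.
move=> mD fi gi [N [mN N0 DN]].
rewrite /Rintegral (negligible_integral mN mD fi N0) (negligible_integral mN mD gi N0).
have mDN : measurable (D `\` N) by exact: measurableD.
apply: le_Rintegral => //.
- exact: integrableS fi.
- exact: integrableS gi.
- by move=> x [Dx nNx]; apply: contrapT => h; apply/nNx/DN => /(_ Dx).
Qed.

Lemma integrable_itv_cat (f : R -> R) (a b c : R) : a <= b -> b <= c ->
  mu.-integrable `[a, b] (EFin \o f) -> mu.-integrable `[b, c] (EFin \o f) ->
  mu.-integrable `[a, c] (EFin \o f).
Proof.
move=> ab bc fi1 fi2.
have E : `[a, c]%classic = `[a, b] `|` `]b, c].
  apply/seteqP; split => z /=; rewrite !in_itv /=.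
    by case: (leP z b) => zb /andP[az zc]; [left|right]; rewrite ?az ?zc ?zb.
  by case=> /andP[h1 h2]; apply/andP; split; lra.
have {}fi2 : mu.-integrable `]b, c] (EFin \o f).
  by apply: integrableS fi2 => //; apply: subset_itvr; rewrite bnd_simp.
have [mf1 fi1'] := integrableP _ _ _ fi1; have [mf2 fi2'] := integrableP _ _ _ fi2.
have mf : measurable_fun (`[a, b] `|` `]b, c]) (EFin \o f) by apply/measurable_funU.
apply/integrableP; rewrite E; split => //.
rewrite ge0_integral_setU //.
- exact: lte_add_pinfty.
- exact: measurableT_comp.
- apply/disj_setPS => y [/=]; rewrite !in_itv /= => /andP[_ yb] /andP[].
  by rewrite ltNge yb.
Qed.

Lemma Rintegral_itv_cat (f : R -> R) (a b c : R) : a <= b -> b <= c ->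
  mu.-integrable `[a, c] (EFin \o f) ->
  \int[mu]_(x in `[a, c]) f x =
  \int[mu]_(x in `[a, b]) f x + \int[mu]_(x in `[b, c]) f x.
Proof.
move=> ab bc fi.
have := @Rintegral_itvB _ f (BLeft a) (BRight c) b fi.
rewrite !bnd_simp => /(_ ab bc).
rewrite Rintegral_itv_obnd_cbnd => [<-|]; first by rewrite addrC subrK.
apply: integrableS fi => //; apply: subset_itv; rewrite bnd_simp //.
Qed.

Lemma Rintegral_derive1 (h : R -> R) (a b : R) : a <= b ->
  (forall x, derivable h x 1) -> continuous (h^`())%classic ->
  \int[mu]_(s in `[a, b]) (h^`())%classic s = h b - h a.
Proof.
rewrite le_eqVlt => /predU1P[<- _ _|ab dh ch].
  by rewrite set_itv1 Rintegral_set1 subrr.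
have hcont : continuous h by move=> x; apply/differentiable_continuous/derivable1_diffP.
have ch' := @continuous_subspaceT _ _ `[a, b]%classic _ ch.
have hab : derivable_oo_LRcontinuous h a b.
  split; [by move=> x _; exact: dh|exact/cvg_at_right_filter/hcont|].
  exact/cvg_at_left_filter/hcont.
by rewrite /Rintegral (continuous_FTC2 ab ch' hab (fun x _ => erefl)).
Qed.

(** A zero with nonzero derivative is isolated in the zero set, and a subset of the line has only
    countably many isolated points. For a path this says that the velocity vanishes at almost every
    time spent at the origin. *)
Lemma derive1_zero_ae (h : R -> R) : (forall x, derivable h x 1) ->
  {ae mu, forall s, h s = 0 -> (h^`())%classic s = 0}.
Proof.
move=> dh; pose S := [set s | h s = 0].
have mS := countable_measurable (@measurable_set1 R) (countable_isolated S).
exists (isolated S); split => //; first exact: countable_lebesgue_measure0 (countable_isolated S).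
move=> s /= /not_implyP[hs h's]; split; first by rewrite inE.
have e0 : 0 < `|(h^`())%classic s| / 2 by rewrite divr_gt0 // normr_gt0; apply/eqP.
have dhs : is_derive s (1 : R) h ((h^`())%classic s) by rewrite derive1E; exact/derivableP.
have [d d0 Hd] := is_derive_near dhs e0.
exists (ball s d); first exact: nbhsx_ballx.
apply/seteqP; split => [y [ys hy]|_ ->] /=; last by split => //; exact: ballxx.
apply/eqP; rewrite -subr_eq0 -normr_le0.
have := Hd y; rewrite hs hy subrr sub0r normrN normrM distrC => /(_ ys).
rewrite distrC; have := normr_ge0 (y - s).
by move: e0; set u := `|(h^`())%classic s|; set v := `|y - s| => *; nra.
Qed.

End IntegralLemmas.

(** * Integrability of the path cost and lower bounds for it *)

Section PathCost.
Context {R : realType}.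
Local Notation mu := (@lebesgue_measure R).
Variable kappa : R.
Local Notation lam := (rate kappa 0).
Hypotheses (lam_ge0 : 0 <= lam) (lam_le1 : lam <= 1).

Definition path_cost (w : R -> R) (s : R) : R :=
  rate kappa (w s) * g0 ((w^`())%classic s / rate kappa (w s)).

Lemma rate_ge0 x : 0 <= rate kappa x.
Proof. by move: lam_ge0; rewrite /rate eqxx; case: ifP. Qed.

Lemma path_cost_ge0 w s : 0 <= path_cost w s.
Proof. by rewrite mulr_ge0 ?g0_ge0 ?rate_ge0. Qed.

(** The factor [l] cancels the division in the linear bound on [g0], which makes the estimate
    uniform in the rate. For l = 0 the quotient is 0 by convention and the product vanishes. *)
Lemma scaled_g0_le_norm (u l : R) : 0 <= l <= 1 -> l * g0 (u / l) <= 1 + `|u|.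
Proof.
move=> /andP[l0 l1].
have [->|l_neq0] := eqVneq l 0; first by rewrite mul0r; have := normr_ge0 u; lra.
apply: le_trans (ler_wpM2l l0 (g0_le_norm _)) _.
have -> : u / l = l^-1 * u by rewrite mulrC.
rewrite normrM ger0_norm ?invr_ge0 // mulrDr mulr1 mulrA mulfV // mul1r.
by lra.
Qed.

Lemma path_cost_le w s : path_cost w s <= 1 + `|(w^`())%classic s|.
Proof.
by apply: scaled_g0_le_norm; rewrite rate_ge0 /=; move: lam_le1; rewrite /rate eqxx; case: ifP.
Qed.

(** At the origin the velocity is 0 and the cost is lam/4; elsewhere the rate is 1 and duality
    applies. Keeping [F] separate from [p] serves two uses: F = lam/4 for every path, and F = 1/4
    with p = 1/2 for paths that avoid the origin. *)
Lemma path_cost_ge w s (F p : R) : 0 <= p <= 1 -> F <= p * (1 - p) ->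
  (F <= lam / 4 \/ w s != 0) -> (w s = 0 -> (w^`())%classic s = 0) ->
  F - p * (w^`())%classic s <= path_cost w s.
Proof.
move=> p01 Fp Flam w's; rewrite /path_cost.
have [ws0|ws0] := eqVneq (w s) 0.
  by case: Flam => [Flam|/eqP//]; rewrite w's // mul0r g0_0 mulr0 subr0 ws0.
rewrite {1 2}/rate (negbTE ws0) mul1r divr1.
by have := g0_ge ((w^`())%classic s) p01; lra.
Qed.

Definition C1_on (a b : R) (w : R -> R) :=
  exists h : R -> R,
    [/\ forall x, derivable h x 1, continuous (h^`())%classic & {in `[a, b], w =1 h}].

(** The interval of the conclusion is open because the derivative of [w] at a or b depends on values
    outside [a, b]. *)
Lemma C1_on_derive1 (a b : R) (w h : R -> R) : {in `[a, b], w =1 h} ->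
  {in `]a, b[, (w^`())%classic =1 (h^`())%classic}.
Proof.
move=> wh s sab; rewrite !derive1E; apply: near_eq_derive.
have : nbhs s `]a, b[%classic by apply: open_nbhs_nbhs; split => //; exact: interval_open.
by apply: filterS => y yab; apply: wh; apply: subset_itv_oo_cc yab.
Qed.

(** Measurability comes from monotonicity of [g0], and the dominating function 1 + |h'| is
    continuous on a compact interval. The endpoints, where the derivative of [w] is not controlled,
    are removed as a null set. *)
Lemma C1_on_integrable a b w : C1_on a b w -> mu.-integrable `[a, b] (EFin \o path_cost w).
Proof.
move=> [h [dh ch wh]].
have w'h' := C1_on_derive1 wh.
have hcont : continuous h by move=> x; apply/differentiable_continuous/derivable1_diffP.
have mh := continuous_measurable_fun hcont.
have mh' : measurable_fun setT (h^`() : R -> R)%classic by exact: continuous_measurable_fun.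
have mg0 : measurable_fun setT (@g0 R).
  by apply: nonincreasing_measurable => // x y; exact: g0_nonincreasing.
have mcost : measurable_fun `[a, b] (path_cost w).
  apply: measurable_fun_itv_cc.
  apply: (@eq_measurable_fun _ _ _ _ `]a, b[%classic
    (fun s => if h s == 0 then lam * g0 ((h^`())%classic s / lam) else g0 ((h^`())%classic s))).
    move=> s /[1!inE] sab; rewrite /path_cost w'h' // wh; last exact: subset_itv_oo_cc sab.
    by rewrite /rate; case: (h s == 0); rewrite ?eqxx // mul1r divr1.
  apply: (@measurable_funS _ _ _ _ setT) => //.
  apply: measurable_fun_ifT.
  - exact: measurable_fun_eqr.
  - apply: measurable_funM => //; apply: measurableT_comp => //.
    exact: measurable_funM.
  - exact: measurableT_comp.
have ih' : mu.-integrable `[a, b] (EFin \o (fun s => 1 + `|(h^`())%classic s|)).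
  apply: continuous_compact_integrable; first exact: segment_compact.
  apply: (@continuous_subspaceT _ R) => x.
  by apply: cvgD; [exact: cvg_cst|apply: cvg_norm; exact: ch].
have set1ab : measurable ([set a; b] : set R) by apply: measurableU.
have null_ab : mu [set a; b] = 0.
  by apply: countable_lebesgue_measure0; apply: finite_set_countable.
have mE : measurable_fun `[a, b] (EFin \o path_cost w) by exact/measurable_EFinP.
have [_ H] := @negligible_integrable _ _ _ mu _ _ _ set1ab (measurable_itv _) mE null_ab; apply: H.
have mD : measurable (`[a, b] `\` [set a; b] : set R) by exact: measurableD.
have ihD : mu.-integrable (`[a, b] `\` [set a; b]) (EFin \o (fun s => 1 + `|(h^`())%classic s|)).
  by apply: integrableS ih' => // z [].
apply: le_integrable ihD => //.
- by apply/measurable_EFinP; apply: measurable_funS mcost => // z [].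
- move=> s [sab /= /not_orP[sa sb]]; rewrite /= lee_fin.
  rewrite ger0_norm ?path_cost_ge0 // (le_trans (path_cost_le w s)) // w'h' ?ler_norm //.
  move: sab => /=; rewrite !in_itv /= !lt_def => /andP[-> ->].
  by rewrite !andbT; apply/andP; split; apply/eqP => // /esym.
Qed.

(** Integrate [path_cost_ge], with the fundamental theorem of calculus for h'. The pointwise bound
    may fail at the endpoints and at times where h = 0 but h' is not 0, which together form a null
    set. *)
Lemma C1_on_cost_ge a b w (F p : R) : a <= b -> C1_on a b w ->
  0 <= p <= 1 -> F <= p * (1 - p) ->
  (F <= lam / 4 \/ {in `]a, b[, forall s, w s != 0}) ->
  (b - a) * F - p * (w b - w a) <= \int[mu]_(s in `[a, b]) path_cost w s.
Proof.
move=> ab C1w p01 Fp Flam; have iw := C1_on_integrable C1w.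
case: C1w => h [dh ch wh].
have w'h' := C1_on_derive1 wh.
have ih' : mu.-integrable `[a, b] (EFin \o (h^`())%classic).
  apply: continuous_compact_integrable; first exact: segment_compact.
  exact: continuous_subspaceT.
have iF : mu.-integrable `[a, b] (EFin \o (fun=> F)).
  apply: continuous_compact_integrable; first exact: segment_compact.
  by apply: continuous_subspaceT => x; exact: cst_continuous.
have iph' : mu.-integrable `[a, b] (EFin \o (fun s => p * (h^`())%classic s)).
  exact: (integrableZl _ _ ih').
have -> : w b = h b by apply: wh; rewrite in_itv /= lexx ab.
have -> : w a = h a by apply: wh; rewrite in_itv /= lexx ab.
rewrite -(Rintegral_derive1 ab dh ch) -RintegralZl //.
have -> : (b - a) * F = \int[mu]_(s in `[a, b]) F.
  have <- : fine (mu `[a, b]) = b - a.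
    rewrite lebesgue_measure_itv /= lte_fin; case: ltP => // ba /=.
    by have -> : a = b by [lra]; rewrite subrr.
  by rewrite Rintegral_cst // mulrC.
rewrite -RintegralB //.
apply: le_ae_Rintegral => //; first exact: (integrableB _ iF iph').
have null_ab : mu.-negligible [set a; b].
  apply/negligibleP; first exact: measurableU.
  by apply: countable_lebesgue_measure0; apply: finite_set_countable.
have ae_ab : {ae mu, forall s, ~ [set a; b] s}.
  by case: null_ab => N [mN N0 abN]; exists N; split => // s /= /contrapT /abN.
apply: (@filterS2 _ _ (ae_filter_ringOfSetsType mu) _ _ _ _ (derive1_zero_ae dh) ae_ab) => s hs /= /not_orP[sa sb] sab.
have soo : s \in `]a, b[.
  move: sab => /=; rewrite !in_itv /= !lt_def => /andP[-> ->].
  by rewrite !andbT; apply/andP; split; apply/eqP => // /esym.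
rewrite -w'h' //; apply: path_cost_ge => //.
- by case: Flam => [|/(_ _ soo)]; [left|right].
- by rewrite w'h' // wh.
Qed.

(** The bound is required on every subinterval, so that it survives concatenation of pieces and can
    be applied before and after a visit to the origin. *)
Definition admissible_cost (w : R -> R) (a b : R) :=
  mu.-integrable `[a, b] (EFin \o path_cost w) /\
  forall a' b' F p, a <= a' -> a' <= b' -> b' <= b ->
    0 <= p <= 1 -> F <= p * (1 - p) ->
    (F <= lam / 4 \/ {in `]a', b'[, forall s, w s != 0}) ->
    (b' - a') * F - p * (w b' - w a') <= \int[mu]_(s in `[a', b']) path_cost w s.

Lemma C1_on_admissible a b w : C1_on a b w -> admissible_cost w a b.
Proof.
move=> C1w; split; first exact: C1_on_integrable.
move=> a' b' F p aa' a'b' b'b; apply: C1_on_cost_ge => //.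
case: C1w => h [dh ch wh]; exists h; split => // s sab; apply: wh.
by move: sab; rewrite !in_itv /= => /andP[s1 s2]; apply/andP; split; lra.
Qed.

Lemma admissible_cost_cat w a b c : a <= b -> b <= c ->
  admissible_cost w a b -> admissible_cost w b c -> admissible_cost w a c.
Proof.
move=> ab bc [i1 H1] [i2 H2].
have iac := integrable_itv_cat ab bc i1 i2; split => //.
move=> a' b' F p aa' a'b' b'c p01 Fp Flam.
have [b'b|bb'] := leP b' b; first exact: H1.
have [a'b|ba'] := leP a' b; last by apply: H2 => //; exact: ltW.
rewrite (@Rintegral_itv_cat _ _ a' b b') //; [|exact: ltW|]; last first.
  apply: integrableS iac => //; apply: subset_itv; rewrite bnd_simp //.
have h1 : (b - a') * F - p * (w b - w a') <= \int[mu]_(s in `[a', b]) path_cost w s.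
  apply: H1 => //; case: Flam => [|Flam]; [left|right] => // s sab; apply: Flam.
  by move: sab; rewrite !in_itv /= => /andP[s1 s2]; apply/andP; split; lra.
have h2 : (b' - b) * F - p * (w b' - w b) <= \int[mu]_(s in `[b, b']) path_cost w s.
  apply: H2 => //; first exact: ltW.
  case: Flam => [|Flam]; [left|right] => // s sab; apply: Flam.
  by move: sab; rewrite !in_itv /= => /andP[s1 s2]; apply/andP; split; lra.
by move: h1 h2; lra.
Qed.

Lemma piecewise_C1_admissible t w : piecewise_C1 t w -> admissible_cost w 0 t.
Proof.
move=> [_ [s [sp C1w]]].
suff H a : itv_partition a t s ->
    (forall i, (i < size s)%N -> C1_on (nth 0 (a :: s) i) (nth 0 s i) w) ->
    admissible_cost w a t by exact: H sp C1w.
(* With no breakpoint left the interval is a single point, where [w] agrees with a constant. *)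
elim: s a {sp C1w} => [a /itv_partition_nil <- _|b s ih a sp C1w].
  apply: C1_on_admissible; exists (cst (w a)); split.
  - by move=> x; exact: derivable_cst.
  - have -> : ((cst (w a) : R -> R)^`())%classic = cst 0.
      by apply/funext => x; rewrite derive1_cst.
    exact: cst_continuous.
  - by move=> x; rewrite in_itv /= => xa; congr w; apply/esym/le_anti.
have ab : a <= b by case: sp => /= /andP[/ltW].
have bt := itv_partition_le (itv_partition_cons sp).
apply: (admissible_cost_cat ab bt); first exact: C1_on_admissible (C1w 0%N _).
apply: ih (itv_partition_cons sp) _ => i iS.
exact: (C1w i.+1).
Qed.

End PathCost.

(** * The initial height as a primitive of the profile *)

Section InitialHeight.
Context {R : realType}.
Local Notation mu := (@lebesgue_measure R).
Variable rho0 : R -> R.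
Hypotheses (rho0_01 : forall x, 0 <= rho0 x <= 1) (mrho0 : measurable_fun setT rho0).
Local Notation v0 := (initial_height rho0).

Lemma profile_integrable a b : mu.-integrable `[a, b] (EFin \o rho0).
Proof.
apply: measurable_bounded_integrable => //.
- by rewrite /= lebesgue_measure_itv /=; case: ifP => // _; rewrite -EFinB ltry.
- exact: measurable_funS mrho0.
- exists 1; split => // y y1 x _ /=.
  by have /andP[h0 h1] := rho0_01 x; rewrite ger0_norm // (le_trans h1) // ltW.
Qed.

Lemma initial_height_sub a b : a <= b -> v0 b - v0 a = \int[mu]_(y in `[a, b]) rho0 y.
Proof.
move=> ab; rewrite /initial_height; have int := profile_integrable.
have [a0|a0] := leP 0 a.
  by rewrite (le_trans a0 ab) (Rintegral_itv_cat a0 ab) // addrC addKr.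
have [b0|b0] := leP 0 b.
  by rewrite (Rintegral_itv_cat (ltW a0) b0) // opprK addrC.
by rewrite (Rintegral_itv_cat ab (ltW b0)) // opprK addrC addrK.
Qed.

Lemma initial_height0 : v0 0 = 0.
Proof. by rewrite /initial_height lexx set_itv1 Rintegral_set1. Qed.

Lemma initial_height_bounds (lo hi a b : R) : (forall x, lo <= rho0 x <= hi) ->
  a <= b -> lo * (b - a) <= v0 b - v0 a <= hi * (b - a).
Proof.
move=> bnd ab; rewrite initial_height_sub //.
have cstE (k : R) : k * (b - a) = \int[mu]_(y in `[a, b]) k.
  have <- : fine (mu `[a, b]) = b - a.
    rewrite lebesgue_measure_itv /= lte_fin; case: ltP => // ba /=.
    by have -> : a = b by [lra]; rewrite subrr.
  by rewrite Rintegral_cst.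
have icst (k : R) : mu.-integrable `[a, b] (EFin \o (fun=> k)).
  apply: continuous_compact_integrable; first exact: segment_compact.
  by apply: continuous_subspaceT => x; exact: cst_continuous.
rewrite !cstE; apply/andP; split; apply: le_Rintegral => //; try exact: profile_integrable.
  by move=> x _; case/andP: (bnd x).
by move=> x _; case/andP: (bnd x).
Qed.

(** [FTC1] is applied to the primitives with base point -n, which differ from [v0] by constants to
    the right of -n; a countable intersection over n covers the line. *)
Lemma initial_height_derive : {ae mu, forall x, is_derive x (1 : R) v0 (rho0 x)}.
Proof.
have locint : locally_integrable setT rho0.
  split => //; first exact: openT.
  move=> K _ cK; have mK := compact_measurable cK.
  have : mu.-integrable K (EFin \o rho0).
    apply: measurable_bounded_integrable => //.
    - exact: compact_finite_measure.
    - exact: measurable_funS mrho0.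
    - exists 1; split => // y y1 x _ /=.
      by have /andP[h0 h1] := rho0_01 x; rewrite ger0_norm // (le_trans h1) // ltW.
  by case/integrableP.
have H n : {ae mu, forall x : R, - n%:R < x -> is_derive x (1 : R) v0 (rho0 x)}.
  have := @FTC1 _ rho0 (BLeft (- n%:R)) (fun y => profile_integrable _ y) locint.
  apply: filterS; first exact: (ae_filter_ringOfSetsType mu).
  move=> x Hx nx; have [|dF F'x] := Hx; first by rewrite /= lte_fin.
  have dF' : is_derive x (1 : R)
      ((fun y => \int[mu]_(t in `[- n%:R, y]) rho0 t) + cst (v0 (- n%:R)))
      (rho0 x + 0).
    apply: is_deriveD.
    by split; [exact: dF|rewrite -derive1E; exact: F'x].
  rewrite -[rho0 x]addr0; apply: near_eq_is_derive dF'.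
  have : nbhs x `]- n%:R, +oo[%classic.
    by apply: open_nbhs_nbhs; split; [exact: interval_open|rewrite /= in_itv /= nx].
  apply: filterS => y; rewrite /= in_itv /= andbT => ny.
  by rewrite /GRing.add /= -initial_height_sub ?ltW // subrK.
apply: (@filterS _ _ (ae_filter_ringOfSetsType mu) _ _ _ (ae_foralln H)) => x Hx; apply: (Hx (Num.bound `|x|)).
by have := archi_boundP (normr_ge0 x); rewrite ltr_norml => /andP[].
Qed.

End InitialHeight.

(** * Redirecting a path just before its final time *)

Section JumpPath.
Context {R : realType}.
Local Notation mu := (@lebesgue_measure R).
Variable kappa : R.
Local Notation lam := (rate kappa 0).
Hypotheses (lam_ge0 : 0 <= lam) (lam_le1 : lam <= 1).

Definition jump_path (w : R -> R) (c u s : R) : R :=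
  if s <= c then w s else w c + u * (s - c).

Lemma jump_path_continuous (w : R -> R) (c u t : R) : 0 <= c <= t ->
  {within `[0, t], continuous w} -> {within `[0, t], continuous (jump_path w c u)}.
Proof.
move=> /andP[c0 ct] wcont.
have -> : `[0, t]%classic = `[0, c] `|` `[c, t].
  apply/seteqP; split => z /=; rewrite !in_itv /=.
    by case: (leP z c) => zc /andP[z0 zt]; [left|right]; rewrite ?z0 ?zt ?(ltW zc).
  by case=> /andP[h1 h2]; apply/andP; split; lra.
apply: withinU_continuous; try exact: interval_closed.
- apply: (@subspace_eq_continuous _ _ _ w).
    by move=> s; rewrite inE /= in_itv /= => /andP[_ sc]; rewrite /jump_path /from_subspace sc.
  apply: continuous_subspaceW wcont.
  by apply: subset_itvl; rewrite bnd_simp.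
- apply: (@subspace_eq_continuous _ _ _ (fun s : R => w c + u * (s - c))).
    move=> s; rewrite inE /= in_itv /= => /andP[cs _]; rewrite /jump_path /from_subspace.
    case: ifP => // sc; have -> : s = c by lra.
    by rewrite subrr mulr0 addr0.
  apply: (@continuous_subspaceT _ R) => s.
  apply: cvgD; first exact: cvg_cst.
  by apply: cvgM; [exact: cvg_cst|apply: cvgB; [exact: cvg_id|exact: cvg_cst]].
Qed.

Lemma affine_derive1 (v u c : R) :
  (forall x, derivable (fun s : R => v + u * (s - c)) x 1) /\
  ((fun s : R => v + u * (s - c))^`())%classic = cst u.
Proof.
have H x : is_derive x (1 : R) (fun s : R => v + u * (s - c)) u.
  have -> : (fun s : R => v + u * (s - c)) = cst (v - u * c) + u \*: id.
    by apply/funext => s; rewrite -[RHS]/((v - u * c) + u * s); ring.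
  rewrite -[X in is_derive _ _ _ X]add0r -[X in 0 + X]mulr1.
  exact: is_deriveD.
split => [x|]; first by case: (H x).
by apply/funext => x; rewrite derive1E; case: (H x).
Qed.

(** Isolates the last interval of a partition; with [C1_on] for [P], this is how the breakpoint c is
    inserted into the last piece. *)
Lemma consecutive_rcons (P : R -> R -> Prop) (a b : R) (s : seq R) :
  (forall i, (i < size (rcons s b))%N ->
     P (nth 0 (a :: rcons s b) i) (nth 0 (rcons s b) i)) <->
  (forall i, (i < size s)%N -> P (nth 0 (a :: s) i) (nth 0 s i)) /\ P (last a s) b.
Proof.
have nthl i : (i < size s)%N -> nth 0 (a :: rcons s b) i = nth 0 (a :: s) i.
  by move=> iS; rewrite -rcons_cons nth_rcons /= ltnS (ltnW iS).
have nthr i : (i < size s)%N -> nth 0 (rcons s b) i = nth 0 s i.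
  by move=> iS; rewrite nth_rcons iS.
have nthls : nth 0 (a :: rcons s b) (size s) = last a s.
  by rewrite -rcons_cons nth_rcons ltnSn (last_nth 0).
have nthrs : nth 0 (rcons s b) (size s) = b by rewrite nth_rcons ltnn eqxx.
rewrite size_rcons; split => [H|[H1 H2] i].
  split=> [i iS|]; last by have := H (size s) (ltnSn _); rewrite nthls nthrs.
  by rewrite -nthl // -nthr //; apply: H; exact: ltnW.
rewrite ltnS leq_eqVlt => /predU1P[->|iS]; first by rewrite nthls nthrs.
by rewrite nthl // nthr //; exact: H1.
Qed.

Lemma jump_path_piecewise_C1 (w : R -> R) (s : seq R) (c u t : R) : itv_partition 0 t (rcons s t) ->
  last 0 s < c < t ->
  {within `[0, t], continuous w} ->
  (forall i, (i < size (rcons s t))%N ->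
     C1_on (nth 0 (0 :: rcons s t) i) (nth 0 (rcons s t) i) w) ->
  piecewise_C1 t (jump_path w c u).
Proof.
move=> sp /andP[sc ct] wcont C1w.
have [p0 _] := sp; move: p0; rewrite rcons_path => /andP[ps slt].
have last_ge0 : 0 <= last 0 s by apply: (@itv_partition_le _ _ _ _ s); split.
split; first by apply: jump_path_continuous => //; apply/andP; split; lra.
exists (rcons (rcons s c) t); split.
  by split; rewrite ?last_rcons // !rcons_path last_rcons ps sc ct.
have C1_low a b : a <= b -> b <= c -> C1_on a b w -> C1_on a b (jump_path w c u).
  move=> ab bc [h [dh ch wh]]; exists h; split => // x xab.
  rewrite -wh // /jump_path ifT //.
  by move: xab; rewrite in_itv /= => /andP[_ /le_trans]; apply.
have /(consecutive_rcons (fun a b => C1_on a b w))[C1s [h [dh ch wh]]] := C1w.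
apply/(consecutive_rcons (fun a b => C1_on a b (jump_path w c u))); split.
  apply/(consecutive_rcons (fun a b => C1_on a b (jump_path w c u))); split.
    move=> i iS; have := iS; rewrite -ltnS => iS'.
    have le_nth : nth 0 (0 :: s) i <= nth 0 s i.
      by apply/ltW; move/(pathP 0): ps; apply.
    have nth_c : nth 0 s i <= c.
      have sp' : itv_partition 0 (last 0 s) s by split.
      by apply: le_trans (ltW sc); have := itv_partition_nth_le iS' sp'; rewrite /= (set_nth_default 0).
    by apply: C1_low => //; exact: C1s.
  apply: C1_low => //; first exact: ltW.
  exists h; split => // x xab; apply: wh.
  by move: xab; rewrite !in_itv /= => /andP[-> xc]; rewrite (le_trans xc) // ltW.
rewrite last_rcons.
have [da d'a] := affine_derive1 (w c) u c.
exists (fun x => w c + u * (x - c)); split.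
- exact: da.
- by rewrite d'a; exact: cst_continuous.
- move=> x; rewrite in_itv /= => /andP[cx xt]; rewrite /jump_path.
  by case: ifP => // xc; have -> : x = c by [lra]; rewrite subrr mulr0 addr0.
Qed.

(** Before c the costs agree. After c the new path has rate 1 at almost every time and speed at
    least 1, so it pays nothing to the right and its speed to the left, while the cost of [w] there
    is nonnegative. *)
Lemma jump_path_cost w c u t : 0 <= c -> c < t -> 1 <= `|u| ->
  piecewise_C1 t w -> piecewise_C1 t (jump_path w c u) ->
  \int[mu]_(s in `[0, t]) path_cost kappa (jump_path w c u) s <=
  \int[mu]_(s in `[0, t]) path_cost kappa w s + (t - c) * Num.max 0 (- u).
Proof.
move=> c0 ct u1 pw pj.
have [iw _] := piecewise_C1_admissible lam_ge0 lam_le1 pw.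
have [ij _] := piecewise_C1_admissible lam_ge0 lam_le1 pj.
have sub1 : `[0, c] `<=` `[0, t]%classic by apply: subset_itvl; rewrite bnd_simp ltW.
have sub2 : `[c, t] `<=` `[0, t]%classic by apply: subset_itvr; rewrite bnd_simp.
rewrite (Rintegral_itv_cat c0 (ltW ct) ij) (Rintegral_itv_cat c0 (ltW ct) iw) -addrA.
(* The last excluded time is the only one at which the straight final piece can meet the origin. *)
have ae_neq : {ae mu, forall s, s <> c /\ s <> t /\ s <> c - w c / u}.
  have : mu.-negligible [set c; t; c - w c / u].
    apply/negligibleP; first by apply: measurableU => //; exact: measurableU.
    by apply: countable_lebesgue_measure0; apply: finite_set_countable.
  move=> [N [mN N0 HN]]; exists N; split => // s /= Hs; apply: HN => /=.
  by apply: contrapT => h; apply: Hs; split; [|split] => ?; apply: h; tauto.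
have j_low s : s < c -> path_cost kappa (jump_path w c u) s = path_cost kappa w s.
  move=> sc; rewrite /path_cost; congr (rate kappa _ * g0 (_ / rate kappa _)).
  - by rewrite /jump_path ltW.
  - rewrite !derive1E; apply: near_eq_derive.
    have : nbhs s `]-oo, c[%classic by apply: open_nbhs_nbhs; split => //; exact: interval_open.
    by apply: filterS => y; rewrite /= in_itv /= /jump_path => /ltW ->.
  - by rewrite /jump_path ltW.
have j_high s : c < s -> s <> c - w c / u ->
    path_cost kappa (jump_path w c u) s <= Num.max 0 (- u).
  move=> cs su.
  have u_neq0 : u != 0 by apply: contraTneq u1 => ->; rewrite normr0 ler10.
  have j's : ((jump_path w c u)^`())%classic s = u.
    have [_ d'a] := affine_derive1 (w c) u c.
    rewrite -[RHS]/(cst u s) -d'a !derive1E; apply: near_eq_derive.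
    have : nbhs s `]c, +oo[%classic.
      by apply: open_nbhs_nbhs; split; [exact: interval_open|rewrite /= in_itv /= cs].
    by apply: filterS => y; rewrite /= in_itv /= andbT /jump_path leNgt => ->.
  rewrite /path_cost j's /rate.
  have -> : jump_path w c u s == 0 = false.
    apply/eqP; rewrite /jump_path leNgt cs /= => h; apply: su.
    have -> : w c = - (u * (s - c)) by lra.
    by field.
  rewrite mul1r divr1 le_max.
  case: (lerP 0 u) u1 => [/ger0_norm ->|/ltW/ler0_norm ->] u1; first by rewrite g0_ge1.
  by rewrite g0_leN1 ?orbT //; lra.
apply: lerD.
  apply: le_ae_Rintegral => //.
  - exact: integrableS ij.
  - exact: integrableS iw.
  - apply: (@filterS _ _ (ae_filter_ringOfSetsType mu) _ _ _ ae_neq) => s [sc _] /=.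
    rewrite in_itv /= => /andP[_ s_le]; rewrite j_low // lt_neqAle s_le andbT.
    exact/eqP.
have -> : (t - c) * Num.max 0 (- u) = \int[mu]_(s in `[c, t]) Num.max 0 (- u).
  have <- : fine (mu `[c, t]) = t - c.
    by rewrite lebesgue_measure_itv /= lte_fin ct.
  by rewrite Rintegral_cst // mulrC.
have imax : mu.-integrable `[c, t] (EFin \o (fun=> Num.max 0 (- u))).
  apply: continuous_compact_integrable; first exact: segment_compact.
  by apply: continuous_subspaceT => x; exact: cst_continuous.
have icj : mu.-integrable `[c, t] (EFin \o path_cost kappa (jump_path w c u)).
  exact: integrableS ij.
have jump_le : \int[mu]_(s in `[c, t]) path_cost kappa (jump_path w c u) s <=
    \int[mu]_(s in `[c, t]) Num.max 0 (- u).
  apply: le_ae_Rintegral => //.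
  apply: (@filterS _ _ (ae_filter_ringOfSetsType mu) _ _ _ ae_neq) => s [sc [_ su]] /=.
  rewrite in_itv /= => /andP[cs _]; apply: j_high => //.
  by rewrite lt_neqAle cs andbT eq_sym; exact/eqP.
apply: le_trans jump_le _; rewrite lerDr.
by apply: Rintegral_ge0 => s _; exact: path_cost_ge0.
Qed.

Lemma within_itv_continuous_left (w : R -> R) (t e : R) : 0 < t -> 0 < e ->
  {within `[0, t], continuous w} ->
  exists2 d, 0 < d & forall s, 0 <= s <= t -> t - s < d -> `|w t - w s| < e.
Proof.
move=> t0 e0 /(continuous_within_itvP _ t0)[_ _ wt].
have /cvgrPdist_lt /(_ _ e0) [d /= d0 Hd] := wt.
exists d => // s /andP[s0 st] ts.
have [->|s_neq] := eqVneq s t; first by rewrite subrr normr0.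
by apply: Hd; rewrite /ball_ /= ?ger0_norm ?subr_ge0 // lt_neqAle s_neq.
Qed.

(* Moving right at speed at least 1 is free and moving left costs the distance, so a jump
   at the final time can be realised with arbitrarily small extra cost. *)
Lemma exists_jump_path w t x e : 0 < t -> 0 < e -> piecewise_C1 t w ->
  exists w', [/\ piecewise_C1 t w', w' 0 = w 0, w' t = x &
    \int[mu]_(s in `[0, t]) path_cost kappa w' s <=
    \int[mu]_(s in `[0, t]) path_cost kappa w s + Num.max 0 (w t - x) + e].
Proof.
move=> t0 e0 pw.
have [<-|wtx] := eqVneq (w t) x.
  by exists w; split => //; rewrite subrr maxxx; lra.
have D0 : 0 < `|x - w t| by rewrite normr_gt0 subr_eq0 eq_sym.
set D := `|x - w t| in D0.
have [wcont [s' [sp C1w]]] := pw.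
have [s sE] : exists s, s' = rcons s t.
  case/lastP: s' sp {C1w} => [/itv_partition_nil t00|s b [_]]; first by rewrite t00 ltxx in t0.
  by rewrite last_rcons => /eqP ->; exists s.
rewrite {}sE {s'} in sp C1w.
have [p0 _] := sp; move: p0; rewrite rcons_path => /andP[ps slt].
have last_ge0 : 0 <= last 0 s by apply: (@itv_partition_le _ _ _ _ s); split.
(* The tolerance e controls the extra cost; D / 2 keeps [w c] at distance at least D / 2 from x. *)
have e'0 : 0 < Num.min e (D / 2) by rewrite lt_min e0; lra.
have [d d0 Hd] := within_itv_continuous_left t0 e'0 wcont.
(* The three bounds serve continuity of [w], a final speed of at least 1, and a jump time inside the
   last piece of the partition. *)
pose eta := Num.min (Num.min (d / 2) (D / 2)) ((t - last 0 s) / 2).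
have eta0 : 0 < eta by rewrite !lt_min; apply/andP; split; [apply/andP; split|]; lra.
have eta_d : eta <= d / 2 by rewrite /eta !ge_min lexx.
have eta_D : eta <= D / 2 by rewrite /eta !ge_min lexx orbT.
have eta_s : eta <= (t - last 0 s) / 2 by rewrite /eta ge_min lexx orbT.
pose c := t - eta; have etaE : t - c = eta by rewrite /c; ring.
have wc : `|w t - w c| < Num.min e (D / 2).
  by apply: Hd; [apply/andP; split|]; rewrite /c; lra.
move: wc; rewrite lt_min => /andP[wce wcD].
pose u := (x - w c) / eta.
have u1 : 1 <= `|u|.
  rewrite /u normrM [X in _ * X]gtr0_norm ?invr_gt0 // ler_pdivlMr // mul1r.
  have : D <= `|x - w c| + `|w t - w c|.
    rewrite /D; have -> : x - w t = (x - w c) - (w t - w c) by ring.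
    exact: ler_normB.
  by lra.
have pj : piecewise_C1 t (jump_path w c u).
  by apply: jump_path_piecewise_C1 sp _ wcont C1w; apply/andP; split; rewrite /c; lra.
exists (jump_path w c u); split => //.
- by rewrite /jump_path ifT // /c; lra.
- rewrite /jump_path leNgt ifF; last by apply/negbTE; rewrite negbK /c; lra.
  by rewrite etaE /u divfK ?gt_eqF //; ring.
have c0 : 0 <= c by rewrite /c; lra.
have ct : c < t by rewrite /c; lra.
apply: le_trans (jump_path_cost c0 ct u1 pw pj) _.
rewrite -addrA lerD2l etaE maxr_pMr ?(ltW eta0) // mulr0.
have -> : eta * - u = w c - x by rewrite /u; field; rewrite gt_eqF.
have := ler_norm (w c - w t); rewrite distrC => h.
rewrite ge_max; apply/andP; split.
  by have : 0 <= Num.max 0 (w t - x) by [rewrite le_max lexx]; lra.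
by have : w t - x <= Num.max 0 (w t - x) by [rewrite le_max lexx orbT]; lra.
Qed.

End JumpPath.

(** * The variational formula and the consequences of invariance *)

Section VariationalHeight.
Context {R : realType}.
Local Notation mu := (@lebesgue_measure R).
Variables (kappa : R) (rho0 : R -> R).
Local Notation lam := (rate kappa 0).
Local Notation q := (rho_star kappa).
Local Notation v0 := (initial_height rho0).
Hypotheses (lam_ge0 : 0 <= lam) (lam_lt1 : lam < 1).
Hypotheses (rho0_01 : forall x, 0 <= rho0 x <= 1) (mrho0 : measurable_fun setT rho0).
Hypothesis rho0_bnd : forall x, q <= rho0 x <= 1 - q.

Let lam_le1 : lam <= 1. Proof. exact: ltW lam_lt1. Qed.

Lemma rho_star_bounds : 0 <= q < 2^-1.
Proof.
have lam0 := lam_ge0; have lam1 := lam_lt1.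
have s1 : Num.sqrt (1 - lam) <= 1.
  have h : 1 - lam <= 1 by lra.
  by have := ler_wsqrtr h; rewrite sqrtr1.
have s0 : 0 < Num.sqrt (1 - lam) by rewrite sqrtr_gt0; lra.
by rewrite /rho_star; apply/andP; split; lra.
Qed.

(** This identifies the flux of the two densities with the cost rate of waiting at the origin, and
    so makes the slopes q and 1 - q usable along paths that visit it. *)
Lemma rho_star_flux : q * (1 - q) = lam / 4.
Proof.
have lam1 := lam_lt1; rewrite /rho_star; set s := Num.sqrt _.
have s2 : s * s = 1 - lam by rewrite -expr2 sqr_sqrtr; lra.
nra.
Qed.

Definition path_value (t : R) (w : R -> R) : R :=
  v0 (w 0) - \int[mu]_(s in `[0, t]) path_cost kappa w s.

Definition admissible_slope (q p : R) := p = q \/ p = 1 - q.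

(* Cost bounds for a path from y to x of duration t and cost C.  In the disjunction, either
   the path visits the origin, and the two slopes are used before and after the visit, or it
   does not, and the slope 1/2 is available. *)
Definition path_data (q t x y C : R) : Prop :=
  (forall p, admissible_slope q p -> t * (q * (1 - q)) - p * (x - y) <= C) /\
  ((forall p p', admissible_slope q p -> admissible_slope q p' ->
      t * (q * (1 - q)) + p * y - p' * x <= C) \/
   (0 < x * y /\ t / 4 - (x - y) / 2 <= C)).

(** A path that visits the origin is cut at the visit, and each half is bounded with its own slope.
    Any other path keeps its sign by the intermediate value theorem and admits F = 1/4 with p =
    1/2. *)
Lemma path_data_cost t w : 0 < t -> piecewise_C1 t w ->
  path_data q t (w t) (w 0) (\int[mu]_(s in `[0, t]) path_cost kappa w s).
Proof.
move=> t0 pw; have [iw Hw] := piecewise_C1_admissible lam_ge0 lam_le1 pw.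
have /andP[q0 q2] := rho_star_bounds; have qf := rho_star_flux.
have slopeP p : admissible_slope q p -> (0 <= p <= 1) /\ q * (1 - q) = p * (1 - p).
  by case=> ->; (split; first by apply/andP; split; lra); ring.
have H a b p : 0 <= a -> a <= b -> b <= t -> admissible_slope q p ->
    (b - a) * (q * (1 - q)) - p * (w b - w a) <= \int[mu]_(s in `[a, b]) path_cost kappa w s.
  move=> a0 ab bt /slopeP[p01 pE]; apply: Hw => //; first by rewrite pE.
  by left; rewrite qf.
split=> [p Hp|].
  by have := H 0 t p (lexx _) (ltW t0) (lexx _) Hp; rewrite subr0.
have [[s [s0t ws0]]|nz] := pselect (exists s, s \in `[0, t] /\ w s = 0).
  left=> p p' Hp Hp'; move: s0t; rewrite in_itv /= => /andP[s0 st].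
  rewrite (Rintegral_itv_cat s0 st iw).
  have := H 0 s p (lexx _) s0 st Hp; have := H s t p' s0 st (lexx _) Hp'.
  by rewrite ws0; lra.
right; have wnz s : s \in `[0, t] -> w s != 0.
  by move=> st; apply/eqP => ws; apply: nz; exists s.
split; last first.
  have := Hw 0 t 4^-1 2^-1 (lexx _) (ltW t0) (lexx _).
  rewrite subr0 => h; suff: t * 4^-1 - 2^-1 * (w t - w 0) <=
    \int[mu]_(s in `[0, t]) path_cost kappa w s by lra.
  apply: h; [lra|lra|right => s st; apply: wnz; exact: subset_itv_oo_cc st].
rewrite ltNge; apply/negP => wle.
case: pw => wcont _.
have [|s st ws] := IVT (ltW t0) wcont (v := 0).
  by rewrite ge_min le_max; case: (lerP 0 (w 0)); case: (lerP 0 (w t)) => *; rewrite ?orbT //=; nra.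
by move/eqP: (wnz s st).
Qed.

Lemma initial_height_slope_bounds a b : a <= b ->
  q * (b - a) <= v0 b - v0 a <= (1 - q) * (b - a).
Proof. exact: initial_height_bounds. Qed.

(** This makes the supremum in [height] finite. The slope 1 - q for a start on the right, or q for
    one on the left, absorbs the initial height at the starting point. *)
Lemma path_value_le t w : 0 < t -> piecewise_C1 t w ->
  path_value t w <= `|w t| - t * (q * (1 - q)).
Proof.
move=> t0 pw; have [H _] := path_data_cost t0 pw.
have /andP[q0 q2] := rho_star_bounds; rewrite /path_value.
have v00 : v0 0 = 0 := initial_height0 rho0.
have n1 := ler_norm (w t); have n0 := normr_ge0 (w t).
have n2 : - w t <= `|w t| by rewrite -normrN ler_norm.
have [w0|w0] := lerP 0 (w 0).
  have /andP[_] := initial_height_slope_bounds w0; rewrite v00 !subr0.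
  by have := H (1 - q) (or_intror erefl); nra.
have /andP[+ _] := initial_height_slope_bounds (ltW w0); rewrite v00.
by have := H q (or_introl erefl); nra.
Qed.

Let values t x := [set initial_height rho0 (w 0) -
           \int[mu]_(s in `[0, t])
             (rate kappa (w s) * g0 ((w^`())%classic s / rate kappa (w s))) |
       w in [set w : R -> R | piecewise_C1 t w /\ w t = x]].

Lemma cst_piecewise_C1 t x : 0 < t -> piecewise_C1 t (cst x : R -> R).
Proof.
move=> t0; split; first by apply: (@continuous_subspaceT _ R) => s; exact: cst_continuous.
exists [:: t]; split; first exact: itv_partition1.
case=> // _; exists (cst x); split => //.
have -> : ((cst x : R -> R)^`())%classic = cst 0.
  by apply/funext => y; rewrite derive1_cst.
exact: cst_continuous.
Qed.

Lemma height_has_sup t x : 0 < t -> has_sup (values t x).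
Proof.
move=> t0; split; first by eexists; exists (cst x) => //; split => //; exact: cst_piecewise_C1.
exists (`|x| - t * (q * (1 - q))) => _ [w [pw <-] <-]; exact: path_value_le.
Qed.

Lemma height_ge t w : 0 < t -> piecewise_C1 t w -> path_value t w <= height kappa rho0 (w t) t.
Proof.
move=> t0 pw; rewrite /height gt_eqF //; apply: sup_upper_bound; first exact: height_has_sup.
by exists w.
Qed.

Lemma height_approx t x e : 0 < t -> 0 < e ->
  exists w, [/\ piecewise_C1 t w, w t = x & height kappa rho0 x t - e < path_value t w].
Proof.
move=> t0 e0; rewrite /height gt_eqF //.
have [_ [w [pw <-] <-] H] := sup_adherent e0 (height_has_sup x t0).
by exists w.
Qed.

(** A near-optimal path to x is redirected to x' at the last moment. Hence the height is
    nondecreasing and 1-Lipschitz in space. *)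
Lemma height_shift t x x' : 0 < t ->
  height kappa rho0 x t - Num.max 0 (x - x') <= height kappa rho0 x' t.
Proof.
move=> t0; apply/ler_addgt0Pr => e e0.
have e2 : 0 < e / 2 by lra.
have [w [pw wt Hw]] := height_approx x t0 e2.
have [w' [pw' w'0 w't Hw']] := exists_jump_path lam_ge0 lam_le1 x' t0 e2 pw.
have := height_ge t0 pw'; rewrite w't; move: Hw Hw'.
by rewrite /path_value w'0 wt; lra.
Qed.

Lemma height0_ge t : 0 < t -> - (t * (q * (1 - q))) <= height kappa rho0 0 t.
Proof.
move=> t0; have := height_ge t0 (cst_piecewise_C1 0 t0).
apply: le_trans; rewrite /path_value /= initial_height0 sub0r lerN2.
have -> : path_cost kappa (cst 0) = cst (q * (1 - q)).
  by apply/funext => s; rewrite /path_cost derive1_cst mul0r g0_0 rho_star_flux.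
have mu0t : fine (mu `[0, t]) = t.
  by rewrite lebesgue_measure_itv /= lte_fin t0 /= oppr0 addr0.
have -> : \int[mu]_(s in `[0, t]) cst (q * (1 - q)) s = q * (1 - q) * t.
  by rewrite Rintegral_cst //; congr (_ * _); exact: mu0t.
by rewrite mulrC.
Qed.

Lemma invariant_height t x : invariant_profile kappa rho0 -> 0 < t ->
  v0 x - t * (q * (1 - q)) <= height kappa rho0 x t.
Proof.
move=> inv t0; pose D y := height kappa rho0 y t - v0 y.
(* Both heights have difference quotients in [0, 1], so those of [D] lie in [-1, 1]. Once [D] is
   known to be constant, it is evaluated at the origin. *)
have D_lip a b : a <= b -> `|D b - D a| <= 1 * (b - a).
  move=> ab.
  have /andP[h1 h2] := initial_height_slope_bounds ab.
  have := height_shift a b t0; have := height_shift b a t0.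
  rewrite max_r ?max_l; [|lra..] => h3 h4.
  have /andP[q0 q2] := rho_star_bounds.
  rewrite ler_norml /D; apply/andP; split; nra.
have D_der : {ae mu, forall y, is_derive y (1 : R) D (0 : R)}.
  have H1 := inv t (ltW t0); have H2 := initial_height_derive rho0_01 mrho0.
  apply: (@filterS2 _ _ (ae_filter_ringOfSetsType mu) _ _ _ _ H1 H2) => y h1 h2.
  rewrite -[X in is_derive _ _ _ X](subrr (rho0 y)); exact: is_deriveB.
have := lipschitz_derive0_constant ler01 D_lip D_der x 0.
have := height0_ge t0; rewrite /D initial_height0; lra.
Qed.

Lemma invariant_path_data t x e : invariant_profile kappa rho0 -> 0 < t -> 0 < e ->
  exists y C, path_data q t x y C /\ v0 x - t * (q * (1 - q)) - e < v0 y - C.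
Proof.
move=> inv t0 e0; have [w [pw wt Hw]] := height_approx x t0 e0.
exists (w 0), (\int[mu]_(s in `[0, t]) path_cost kappa w s); split.
  by rewrite -wt; exact: path_data_cost.
by have := invariant_height x inv t0; move: Hw; rewrite /path_value; lra.
Qed.

End VariationalHeight.

(** * The shape of the height on each side of the origin *)

Section Dichotomy.
Context {R : realType}.
Implicit Types (q t x y z C : R) (V : R -> R).

(** A near-optimal path survives only through its starting point y and its cost C. The function [V]
    is abstract so that it can be the initial height or its reflection. *)
Definition near_optimal_data q V :=
  forall t x e, 0 < t -> 0 < e ->
    exists y C, path_data q t x y C /\ V x - t * (q * (1 - q)) - e < V y - C.

Definition slopes_between q V :=
  forall a b, a <= b -> q * (b - a) <= V b - V a <= (1 - q) * (b - a).

Lemma maximal_slope_beyond q V x z : 0 <= q < 2^-1 -> V 0 = 0 ->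
  slopes_between q V -> near_optimal_data q V ->
  0 < x -> q * x < V x -> 0 <= z -> V (x + z) - V x = (1 - q) * z.
Proof.
move=> /andP[q0 q2] V0 slopeV optV x0 Vx z0.
apply/eqP; rewrite eq_le; apply/andP; split.
  by have /andP[_] := slopeV x (x + z) ltac:(lra); have -> : x + z - x = z by ring.
apply/ler_addgt0Pr => e e0.
have Vx_ge : 0 <= V x by nra.
have f4 : 0 < 4^-1 - q * (1 - q) by nra.
set f := q * (1 - q) in f4 *.
(* By this time avoiding the origin loses 2 x + z + 1 more than t f, too much for a path that starts
   in (0, x + z]. *)
pose t := (2 * x + z + 1) / (4^-1 - f).
have t0 : 0 < t by rewrite divr_gt0 //; lra.
have tE : t / 4 = 2 * x + z + 1 + t * f.
  have : t * (4^-1 - f) = 2 * x + z + 1 by rewrite /t divfK // gt_eqF.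
  by rewrite mulrBr; lra.
(* The bound e is the final error, 1 excludes starting points up to x + z, and V x - q x excludes
   visits to the origin. *)
have e'0 : 0 < Num.min (Num.min e 1) (V x - q * x) by rewrite !lt_min e0 ltr01; lra.
have [y [C [[Hp Hc]]]] := optV t x _ t0 e'0.
set e' := Num.min _ _ => Hv.
have e'e : e' <= e by rewrite /e' !ge_min lexx.
have e'1 : e' <= 1 by rewrite /e' !ge_min lexx !orbT.
have e'V : e' <= V x - q * x by rewrite /e' !ge_min lexx !orbT.
rewrite -/f in Hp Hc Hv.
case: Hc => [Hc|[xy Hc]].
  (* Slope q after the visit, and slope 1 - q or q before it according to the sign of y, give V y -
     C <= q x - t f. *)
  exfalso.
  have [y0|y0] := lerP 0 y.
    have /andP[_] := slopeV 0 y y0; rewrite V0 !subr0 => Vy.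
    by have := Hc (1 - q) q (or_intror erefl) (or_introl erefl); lra.
  have /andP[+ _] := slopeV y 0 (ltW y0); rewrite V0 => Vy.
  by have := Hc q q (or_introl erefl) (or_introl erefl); lra.
have y0 : 0 < y by rewrite -(pmulr_rgt0 _ x0).
have [yz|yz] := lerP y (x + z).
  exfalso; have /andP[_] := slopeV 0 y (ltW y0); rewrite V0 !subr0 => Vy.
  have : (1 - q) * y <= y by nra.
  by lra.
(* On [x + z, y] the height gains at most (1 - q)(y - x - z), while the path bound asks for (1 -
   q)(y - x) - e' over [x, y]; the rest must be gained on [x, x + z]. *)
have /andP[_ Vy] := slopeV (x + z) y (ltW yz).
by have := Hp (1 - q) (or_intror erefl); lra.
Qed.

(** The points x >= 0 with V x = q x form an initial segment, because slopes are at least q. Its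
    supremum is the switch point a, and beyond it [maximal_slope_beyond] applies. *)
Lemma profile_right_of_origin q V : 0 <= q < 2^-1 -> V 0 = 0 ->
  slopes_between q V -> near_optimal_data q V ->
  (forall x, 0 <= x -> V x = q * x) \/
  exists2 a, 0 <= a & (forall x, 0 <= x < a -> V x = q * x) /\
    (forall x z, a < x -> 0 <= z -> V (x + z) - V x = (1 - q) * z).
Proof.
move=> q01 V0 slopeV optV.
have Vge x : 0 <= x -> q * x <= V x.
  by move=> x0; have /andP[+ _] := slopeV 0 x x0; rewrite V0 !subr0.
have [H|/existsNP[b /not_implyP[b0 Vb]]] := pselect (forall x, 0 <= x -> V x = q * x); first by left.
right; pose S := [set x | 0 <= x /\ V x = q * x].
have S_down x y : S x -> 0 <= y <= x -> S y.
  move=> [x0 Vx] /andP[y0 yx]; split => //; apply/eqP; rewrite eq_le Vge // andbT.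
  by have /andP[+ _] := slopeV y x yx; rewrite Vx; lra.
have S0 : S 0 by split; rewrite // mulr0.
have Sb x : S x -> x <= b.
  move=> Sx; rewrite leNgt; apply/negP => bx; apply: Vb.
  by have [|] := S_down x b Sx; first by rewrite b0 ltW.
have hS : has_sup S by split; [exists 0|exists b].
exists (sup S); first exact: sup_upper_bound.
split=> [x /andP[x0 xS]|x z Sx z0].
  have [s Ss xs] := sup_gt (ex_intro _ 0 S0) xS.
  by have [|] := S_down s x Ss; first by rewrite x0 ltW.
have x0 : 0 < x by apply: le_lt_trans Sx; exact: sup_upper_bound.
apply: maximal_slope_beyond => //; rewrite lt_neqAle Vge ?ltW // andbT.
apply/eqP => Vx; move: Sx; rewrite ltNge => /negP; apply.
by apply: sup_upper_bound => //; split; [exact: ltW|].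
Qed.

(* Particle-hole reflection: the identity g0 (- u) = g0 u + u turns a path with cost C
   from y to x into a path with cost C + (x - y) from - y to - x. *)
Lemma path_data_reflect q t x y C :
  path_data q t x y C -> path_data q t (- x) (- y) (C + (x - y)).
Proof.
have refl p : admissible_slope q p -> admissible_slope q (1 - p).
  by case=> ->; [right|left; ring].
move=> [Hp Hc]; split => [p /refl/Hp|]; first by lra.
case: Hc => [Hc|[xy Hc]]; [left=> p p' /refl Hq /refl Hq'|right].
  by have := Hc _ _ Hq Hq'; lra.
by split; [rewrite mulrNN|lra].
Qed.

(** The reflected height V(-x) + x has slope 1 - p at x where [V] has slope p at -x, so it satisfies
    the same hypotheses and the result on the right applies to it. *)
Lemma profile_left_of_origin q V : 0 <= q < 2^-1 -> V 0 = 0 ->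
  slopes_between q V -> near_optimal_data q V ->
  (forall x, x <= 0 -> V x = (1 - q) * x) \/
  exists2 a, a <= 0 & (forall x, a < x <= 0 -> V x = (1 - q) * x) /\
    (forall x z, x < a -> 0 <= z -> V x - V (x - z) = q * z).
Proof.
move=> q01 V0 slopeV optV; pose W x := V (- x) + x.
have W0 : W 0 = 0 by rewrite /W oppr0 V0 addr0.
have slopeW : slopes_between q W.
  move=> a b ab; have /andP[h1 h2] := slopeV (- b) (- a) ltac:(lra).
  by rewrite /W; apply/andP; split; lra.
have optW : near_optimal_data q W.
  move=> t x e t0 e0; have [y [C [dat Hv]]] := optV t (- x) e t0 e0.
  exists (- y), (C + (- x - y)); split; last by rewrite /W opprK; lra.
  by have := path_data_reflect dat; rewrite opprK.
case: (profile_right_of_origin q01 W0 slopeW optW) => [H|[a a0 [H1 H2]]]; [left|right].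
  by move=> x x0; have := H (- x) ltac:(lra); rewrite /W opprK; lra.
exists (- a); first lra; split => x.
  move=> /andP[ax x0]; have := H1 (- x) ltac:(apply/andP; split; lra).
  by rewrite /W opprK; lra.
move=> z xa z0; have := H2 (- x) z ltac:(lra) z0.
have -> : - x + z = - (x - z) by ring.
by rewrite /W !opprK; lra.
Qed.

End Dichotomy.

(** * Nonnegativity of the last passage constant *)

Section LastPassageLimit.
Context {R : realType}.

Lemma last_passage_ge0 (r : R) (y : site -> R) (n : nat) : 0 <= r ->
  (forall z, 0 <= y z) -> 0 <= last_passage r y n.
Proof.
move=> r0 y0; rewrite /last_passage; set S := [set _ | _ in _].
(* [sup] is 0 by default on a set without supremum; otherwise any path gives a nonnegative lower
   bound. *)
have [hS|/sup_out -> //] := pselect (has_sup S).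
have [[u Su] _] := hS; have h := sup_upper_bound hS Su. apply: le_trans h.
case: Su => p _ <-; apply: sumr_ge0 => z _; apply: mulr_ge0 => //.
by rewrite /diag_weight; case: ifP => // _; rewrite invr_ge0.
Qed.

(** Some outcome has all variables nonnegative and satisfies the limit, which inherits the sign. As
    division by 0 gives 0, lambda(0) >= 0 follows even for kappa = 0. *)
Lemma is_kappa_ge0 (r kappa : R) : 0 <= r -> is_kappa r kappa -> 0 <= kappa.
Proof.
move=> r0 [d [T [P [Y [[_ Ydist] Ylim]]]]].
have Y_ge0 (z : site) : {ae P, forall w, 0 <= Y z w}.
  exists (Y z @^-1` `]-oo, 0[); split.
  - by rewrite -[X in measurable X]setTI; exact: measurable_funPT.
  - have := Ydist z `]-oo, 0[%classic (measurable_itv _).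
    rewrite /distribution /pushforward => ->.
    rewrite /exponential_prob integral0_eq // => x /=; rewrite in_itv /= => x0.
    by rewrite lt0_exponential_pdf.
  - by move=> w /= /negP; rewrite -ltNge in_itv.
(* Sites are enumerated by their codes to obtain a countable intersection; a number that codes no
   site is sent to the site (0, 0). *)
have Y_ge0_all : {ae P, forall w, forall n : nat, 0 <= Y (odflt (0, 0)%N (unpickle n)) w}.
  by apply: ae_foralln => n; exact: Y_ge0.
have P1 : (0 < P setT)%E by rewrite probability_setT.
have PF := ae_properfilter_algebraOfSetsType P1.
have [w [wlim w0]] := @filter_ex _ _ PF _ (filterI Ylim Y_ge0_all).
have {}w0 z : 0 <= Y z w by have := w0 (pickle z); rewrite pickleK.
have <- := cvg_lim (@Rhausdorff R) wlim.
apply: limr_ge; first by apply/cvg_ex; exists kappa.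
by apply: nearW => n; rewrite divr_ge0 // last_passage_ge0.
Qed.

End LastPassageLimit.

(** * From the slopes of the height to the jumps of the profile *)

Section StepProfile.
Context {R : realType}.
Local Notation mu := (@lebesgue_measure R).

(* The values alternate between lo and hi; e tells whether the first one is hi. *)
Definition alternating (lo hi : R) (e : bool) (i : nat) : R :=
  if e (+) odd i then hi else lo.

Definition step_structure (lo hi : R) (f : R -> R) :=
  exists (s : seq R) (c : nat -> R),
    [/\ (size s <= 3)%N,
        jumps_at s c f,
        forall i, (i <= size s)%N -> c i = lo \/ c i = hi &
        forall i, (i < size s)%N -> c i = hi -> c i.+1 = lo -> s`_i = 0].

(** Alternation makes consecutive values distinct, and the downward jumps are those at the indices i
    with [e (+) odd i]; only these must be located at the origin. *)
Lemma alternating_step_structure (lo hi : R) (f : R -> R) (e : bool) (s : seq R) :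
  lo != hi -> (size s <= 3)%N -> sorted <%R s ->
  (forall i, (i < size s)%N -> e (+) odd i -> s`_i = 0) ->
  {ae mu, forall x, f x = alternating lo hi e (count (fun a => a < x) s)} ->
  step_structure lo hi f.
Proof.
move=> lohi s3 ss down fs; exists s, (alternating lo hi e); split => //.
- by split => // i _; rewrite /alternating /= addbN; case: (e (+) odd i); rewrite //= eq_sym.
- by move=> i _; rewrite /alternating; case: ifP => _; [right|left].
- move=> i iS; rewrite {1}/alternating; case: ifP => [ei _ _|_ lo_hi]; first exact: down.
  by rewrite lo_hi eqxx in lohi.
Qed.

Lemma is_derive_affine_near (V : R -> R) (x x0 v0 m l : R) (I : set R) :
  open I -> I x -> (forall y, I y -> V y = v0 + m * (y - x0)) ->
  is_derive x (1 : R) V l -> l = m.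
Proof.
move=> oI Ix HV dV.
have dA : is_derive x (1 : R) (fun y : R => v0 + m * (y - x0)) l.
  apply: near_eq_is_derive dV.
  have : nbhs x I by exact: open_nbhs_nbhs.
  by apply: filterS => y /HV.
have [_ dE] := affine_derive1 v0 m x0.
have := congr1 (fun g : R -> R => g x) dE; rewrite derive1E => /=.
by have := @derive_val _ _ _ _ _ _ _ dA => -> ->.
Qed.

(** Each half-line carries at most one upward switch, at b <= 0 or a >= 0. Next to the origin the
    values are 1 - q on the left and q on the right, a downward jump, unless a switch sits at the
    origin itself. *)
Lemma profile_structure (q : R) (rho0 V : R -> R) : 0 <= q < 2^-1 -> V 0 = 0 ->
  slopes_between q V -> near_optimal_data q V ->
  {ae mu, forall x, is_derive x (1 : R) V (rho0 x)} ->
  step_structure q (1 - q) rho0.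
Proof.
move=> q01 V0 slopeV optV dV.
have qhi : q != 1 - q by move: q01 => /andP[_ q2]; rewrite lt_eqF //; lra.
have ae_neq (c : R) : {ae mu, forall x, x <> c}.
  exists [set c]; split => //; first exact: lebesgue_measure_set1.
  by move=> x /= /contrapT ->.
have right_ae : {ae mu, forall x : R, 0 < x -> rho0 x = q} \/
    exists2 a, 0 <= a & {ae mu, forall x : R, (0 < x < a -> rho0 x = q) /\
                                        (a < x -> rho0 x = 1 - q)}.
  case: (profile_right_of_origin q01 V0 slopeV optV) => [H|[a a0 [H1 H2]]]; [left|right].
    apply: (@filterS _ _ (ae_filter_ringOfSetsType mu) _ _ _ dV) => x dx x0.
    apply: (@is_derive_affine_near V x 0 0 q _ `]0, +oo[%classic _ _ _ dx).
    - exact: interval_open.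
    - by rewrite /= in_itv /= x0.
    - by move=> y; rewrite /= in_itv /= andbT => /ltW/H ->; rewrite add0r subr0.
  exists a => //; apply: (@filterS _ _ (ae_filter_ringOfSetsType mu) _ _ _ dV) => x dx; split.
    move=> /andP[x0 xa].
    apply: (@is_derive_affine_near V x 0 0 q _ `]0, a[%classic _ _ _ dx).
    - exact: interval_open.
    - by rewrite /= in_itv /= x0.
    - by move=> y; rewrite /= in_itv /= => /andP[y0 ya]; rewrite H1 ?(ltW y0) // add0r subr0.
  (* The affine formula holds from base points strictly beyond a, hence the midpoint between a and
     x. *)
  move=> ax; pose c := (a + x) / 2.
  have ac : a < c by rewrite /c; lra.
  apply: (@is_derive_affine_near V x c (V c) (1 - q) _ `]c, +oo[%classic _ _ _ dx).
  - exact: interval_open.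
  - by rewrite /= in_itv /= andbT /c; lra.
  - move=> y; rewrite /= in_itv /= andbT => cy.
    by have := H2 c (y - c) ac ltac:(lra); rewrite subrKC => <-; ring.
have left_ae : {ae mu, forall x : R, x < 0 -> rho0 x = 1 - q} \/
    exists2 b, b <= 0 & {ae mu, forall x : R, (b < x < 0 -> rho0 x = 1 - q) /\
                                        (x < b -> rho0 x = q)}.
  case: (profile_left_of_origin q01 V0 slopeV optV) => [H|[b b0 [H1 H2]]]; [left|right].
    apply: (@filterS _ _ (ae_filter_ringOfSetsType mu) _ _ _ dV) => x dx x0.
    apply: (@is_derive_affine_near V x 0 0 (1 - q) _ `]-oo, 0[%classic _ _ _ dx).
    - exact: interval_open.
    - by rewrite /= in_itv /= x0.
    - by move=> y; rewrite /= in_itv /= => /ltW/H ->; rewrite add0r subr0.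
  exists b => //; apply: (@filterS _ _ (ae_filter_ringOfSetsType mu) _ _ _ dV) => x dx; split.
    move=> /andP[bx x0].
    apply: (@is_derive_affine_near V x 0 0 (1 - q) _ `]b, 0[%classic _ _ _ dx).
    - exact: interval_open.
    - by rewrite /= in_itv /= bx.
    - by move=> y; rewrite /= in_itv /= => /andP[by_ y0]; rewrite H1 ?by_ ?(ltW y0) // add0r subr0.
  move=> xb; pose c := (b + x) / 2.
  have cb : c < b by rewrite /c; lra.
  apply: (@is_derive_affine_near V x c (V c) q _ `]-oo, c[%classic _ _ _ dx).
  - exact: interval_open.
  - by rewrite /= in_itv /= /c; lra.
  - move=> y; rewrite /= in_itv /= => yc.
    have := H2 c (c - y) cb ltac:(lra).
    by have -> : c - (c - y) = y by [ring]; lra.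
have F := ae_filter_ringOfSetsType mu.
have ae_neq3 (a b : R) : {ae mu, forall x : R, [/\ x <> 0, x <> a & x <> b]}.
  by apply: (@filterS3 _ _ F _ _ _ _ _ (ae_neq 0) (ae_neq a) (ae_neq b)) => x.
case: left_ae right_ae => [L|[b b0 L]] [Rt|[a a0 Rt]].
- apply: (@alternating_step_structure _ _ _ true [:: 0]) => //; first by case.
  apply: (@filterS3 _ _ F _ _ _ _ _ L Rt (ae_neq 0)) => x Lx Rx x0; rewrite /alternating /=.
  by case: (ltrgtP 0 x) x0 => [/Rx -> _|/Lx -> _|-> []].
(* If a = 0 the upward switch cancels the downward jump and the profile is constant. *)
- have [a_eq0|a_neq0] := eqVneq a 0.
    apply: (@alternating_step_structure _ _ _ true [::]) => //.
    apply: (@filterS3 _ _ F _ _ _ _ _ L Rt (ae_neq 0)) => x Lx [_ Rx] x0; rewrite /alternating /=.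
    by case: (ltrgtP 0 x) x0 => [|/Lx -> _|-> []] //; rewrite -a_eq0 => /Rx ->.
  have a_gt0 : 0 < a by rewrite lt_def a_neq0.
  apply: (@alternating_step_structure _ _ _ true [:: 0; a]) => //=; first by rewrite a_gt0.
    by case=> [|[|]].
  apply: (@filterS3 _ _ F _ _ _ _ _ L Rt (ae_neq3 a 0)) => x Lx [R1 R2] [x0 xa _].
  rewrite /alternating /=.
  case: (ltrgtP a x) xa => [ax _|xa _|-> []] //.
    by rewrite (lt_trans a_gt0 ax) /= R2.
  case: (ltrgtP 0 x) x0 => [x0 _|x0 _|-> []] //=; last exact: Lx.
  by apply: R1; rewrite x0.
- have [b_eq0|b_neq0] := eqVneq b 0.
    apply: (@alternating_step_structure _ _ _ false [::]) => //.
    apply: (@filterS3 _ _ F _ _ _ _ _ L Rt (ae_neq 0)) => x [_ Lx] Rx x0; rewrite /alternating /=.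
    by case: (ltrgtP 0 x) x0 => [/Rx -> //||-> []] //; rewrite -b_eq0 => /Lx ->.
  have b_lt0 : b < 0 by rewrite lt_neqAle b_neq0.
  apply: (@alternating_step_structure _ _ _ false [:: b; 0]) => //=; first by rewrite b_lt0.
    by case=> [|[|]].
  apply: (@filterS3 _ _ F _ _ _ _ _ L Rt (ae_neq3 b 0)) => x [L1 L2] Rx [x0 xb _].
  rewrite /alternating /=.
  case: (ltrgtP b x) xb => [bx _|xb _|-> []] //; last first.
    by rewrite ltNge (ltW (lt_trans xb b_lt0)) /= L2.
  case: (ltrgtP 0 x) x0 => [x0 _|x0 _|-> []] //=; first exact: Rx.
  by apply: L1; rewrite bx.
(* With both switches at the origin a single upward jump remains there; with exactly one there, only
   the other switch remains; with none, all three jumps are present. *)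
have [a_eq0|a_neq0] := eqVneq a 0; have [b_eq0|b_neq0] := eqVneq b 0.
- apply: (@alternating_step_structure _ _ _ false [:: 0]) => //; first by case.
  apply: (@filterS3 _ _ F _ _ _ _ _ L Rt (ae_neq 0)) => x [_ Lx] [_ Rx] x0; rewrite /alternating /=.
  rewrite a_eq0 b_eq0 in Lx Rx.
  by case: (ltrgtP 0 x) x0 => [/Rx -> _|/Lx -> _|-> []].
- have b_lt0 : b < 0 by rewrite lt_neqAle b_neq0.
  apply: (@alternating_step_structure _ _ _ false [:: b]) => //; first by case.
  apply: (@filterS3 _ _ F _ _ _ _ _ L Rt (ae_neq3 b 0)) => x [L1 L2] [_ Rx] [x0 xb _].
  rewrite /alternating /=; rewrite a_eq0 in Rx.
  case: (ltrgtP b x) xb => [bx _|xb _|-> []] //=; last exact: L2.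
  by case: (ltrgtP 0 x) x0 => [/Rx -> _|x0 _|-> []] //; apply: L1; rewrite bx.
- have a_gt0 : 0 < a by rewrite lt_def a_neq0.
  apply: (@alternating_step_structure _ _ _ false [:: a]) => //; first by case.
  apply: (@filterS3 _ _ F _ _ _ _ _ L Rt (ae_neq3 a 0)) => x [_ Lx] [R1 R2] [x0 xa _].
  rewrite /alternating /=; rewrite b_eq0 in Lx.
  case: (ltrgtP a x) xa => [ax _|xa _|-> []] //=; first exact: R2.
  by case: (ltrgtP 0 x) x0 => [x0 _|/Lx -> _|-> []] //; apply: R1; rewrite x0.
- have a_gt0 : 0 < a by rewrite lt_def a_neq0.
  have b_lt0 : b < 0 by rewrite lt_neqAle b_neq0.
  apply: (@alternating_step_structure _ _ _ false [:: b; 0; a]) => //=; first by rewrite b_lt0 a_gt0.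
    by case=> [|[|[|]]].
  apply: (@filterS3 _ _ F _ _ _ _ _ L Rt (ae_neq3 a b)) => x [L1 L2] [R1 R2] [x0 xa xb].
  rewrite /alternating /=.
  case: (ltrgtP 0 x) x0 => [x0 _|x0 _|-> []] //.
    rewrite (lt_trans b_lt0 x0) /=.
    by case: (ltrgtP a x) xa => [/R2 -> _|xa _|-> []] //; apply: R1; rewrite x0.
  rewrite [a < x]ltNge (ltW (lt_trans x0 a_gt0)) /=.
  by case: (ltrgtP b x) xb => [bx _|/L2 -> _|-> []] //; apply: L1; rewrite bx.
Qed.

End StepProfile.

(** * Classification of the invariant profiles *)

Unset Implicit Arguments.
Set Strict Implicit.

Theorem corollary2p2 (R : realType) (r kappa : R) (rho0 : R -> R)
    (r_gt0 : 0 < r) (r_le1 : r <= 1)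
    (kappaP : is_kappa r kappa)
    (rate0_lt1 : rate kappa 0 < 1)
    (rho0_01 : forall x, 0 <= rho0 x <= 1)
    (rho0_meas : measurable_fun setT rho0)
    (rho0_pc : forall a b : R, a < b -> piecewise_continuous a b rho0)
    (rho0_bnd : forall x, rho_star kappa <= rho0 x <= 1 - rho_star kappa)
    (rho0_inv : invariant_profile kappa rho0) :
  {ae @lebesgue_measure R, forall x,
      rho0 x = rho_star kappa \/ rho0 x = 1 - rho_star kappa} /\
  exists (s : seq R) (c : nat -> R),
    [/\ (size s <= 3)%N,
        jumps_at s c rho0,
        forall i, (i <= size s)%N ->
          c i = rho_star kappa \/ c i = 1 - rho_star kappa &
        forall i, (i < size s)%N ->
          c i = 1 - rho_star kappa -> c i.+1 = rho_star kappa -> s`_i = 0].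
Proof.
have lam_ge0 : 0 <= rate kappa 0.
  by rewrite /rate eqxx divr_ge0 // (is_kappa_ge0 (ltW r_gt0) kappaP).
have q01 := rho_star_bounds lam_ge0 rate0_lt1.
have [s [c [s3 js cs downs]]] : step_structure (rho_star kappa) (1 - rho_star kappa) rho0.
  apply: (@profile_structure _ _ _ (initial_height rho0)) => //.
  - exact: initial_height0.
  - by move=> a b; exact: initial_height_slope_bounds.
  - by move=> t x e; exact: invariant_path_data.
  - exact: initial_height_derive.
split; last by exists s, c.
(* Almost every value of the profile is some c i with i at most the number of jumps, so the first
   claim follows from the second. *)
have [_ _] := js.
apply: (@filterS _ _ (ae_filter_ringOfSetsType (@lebesgue_measure R))) => x ->.
by apply: cs; exact: count_size.
Qed.
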